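(* Let $k\geq 0$ be an integer. The Diophantine equation $2^x-(2^k\cdot 5)^y=z^2$ has only the non-negative integer solutions $(x,y,z)=(0,0,0)$ and $(x,y,z)=(1,0,1)$. *)

(* Defs.v *)
From mathcomp Require Import all_boot all_order all_algebra.

Set Implicit Arguments.
Unset Strict Implicit.
Unset Printing Implicit Defensive.

(* Main.v *)
Require Import Defs.
From mathcomp Require Import all_boot all_order all_algebra zify.

Import Order.TTheory GRing.Theory Num.Theory.
Local Open Scope ring_scope.

(** For [y > 0], the equation [2^x = z^2 + 2^m * 5^y] has no solution with any
[m]: the right-hand side exceeds 4, so 4 divides it.  As [5^y = 1] and
[z^2 = 0, 1] modulo 4, this excludes [m = 0] and [m = 1], and for [m >= 2] it
makes [z] even, so dividing by 4 replaces [m] by [m - 2]. *)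

Lemma modn4_sqr (z : nat) : (z ^ 2 %% 4 = odd z)%N.
Proof.
rewrite -modnXm; have : (z %% 4 < 4)%N by rewrite ltn_pmod.
have -> : odd z = odd (z %% 4) by rewrite -[in LHS](odd_double_half z); lia.
by case: (z %% 4)%N => [|[|[|[|]]]].
Qed.

Lemma modn4_exp5 (y : nat) : (5 ^ y %% 4 = 1)%N.
Proof. by rewrite -modnXm exp1n. Qed.

Lemma exp2_neq_sqr_add (m x y z : nat) :
  (0 < y)%N -> (2 ^ x)%N <> (z ^ 2 + 2 ^ m * 5 ^ y)%N.
Proof.
move=> y_gt0; have [n le_mn] := ubnP m.
(* The descent lowers [m] by 2, so the induction is on a strict upper bound [n] of [m], with [x] and
   [z] generalized. *)
elim: n => // n IHn in m x z le_mn *.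
have y4 := modn4_exp5 y; have z4 := modn4_sqr z.
have y5 : (5 <= 5 ^ y)%N by rewrite -[X in (X <= _)%N]expn1 leq_exp2l.
have m_gt0 : (0 < 2 ^ m)%N by rewrite expn_gt0.
(* For [x < 2] the left side is at most 2, the right side at least 5. *)
case: x => [|[|x]]; rewrite ?expn0 ?expn1; [by nia | by nia |].
rewrite !(expnS 2 x.+1, expnS 2 x).
case: m => [|[|m]] in le_mn m_gt0 *; rewrite ?expn0 ?expn1; [by lia | by lia |].
rewrite !(expnS 2 m.+1, expnS 2 m) => eq_xz.
have z_even : odd z = false by lia.
apply: (IHn m x z./2); first by lia.
have zE : (z = z./2 * 2)%N by lia.
move: eq_xz; rewrite {1}zE expnMn; lia.
Qed.

Theorem theorem3p4 (k x y z : nat) :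
  (2 : int) ^+ x - (2 ^+ k * 5) ^+ y = z%:Z ^+ 2 <->
  (x, y, z) = (0, 0, 0)%N \/ (x, y, z) = (1, 0, 1)%N.
Proof.
split=> [eq_xyz|[] [-> -> ->] //].
(* Moving the subtracted power across gives an equation in [nat], with [m = k * y]. *)
have {}eq_xyz : (2 ^ x = z ^ 2 + 2 ^ (k * y) * 5 ^ y)%N.
  apply/eqP; rewrite -eqz_nat PoszD PoszM -!natz !natrX; apply/eqP.
  by rewrite exprM -exprMn (natz z) -eq_xyz subrK.
have [y0|/exp2_neq_sqr_add/(_ eq_xyz)//] := posnP y.
(* For [y = 0], [2 ^ x = z ^ 2 + 1] is 1 or 2 modulo 4, so [x < 2]. *)
move: eq_xyz; rewrite y0 muln0 !expn0 muln1.
have z4 := modn4_sqr z.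
case: x => [|[|x]]; rewrite ?expn0 ?expn1 => eq_xz.
- by left; congr (_, _, _); nia.
- by right; congr (_, _, _); nia.
- by move: eq_xz; rewrite !(expnS 2 x.+1, expnS 2 x); lia.
Qed.
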